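(* Let $K \subset \mathbb{R}^3$ be a symmetric convex body. If $K$ is intuitive, then $K$ is an ellipsoid.
   Context: A symmetric convex body $K \subset \mathbb{R}^n$ is a compact convex set with non-empty interior such that $K = -K$. It defines the norm $\|\xi\|_K = \inf\{t > 0 : \xi \in tK\}$ on $\mathbb{R}^n$. For a finite set $P \subset \mathbb{R}^n$, $\Delta_P$ denotes the set of probability distributions on $P$ (weights $W(p)\ge 0$ for $p \in P$ summing to $1$). For $W \in \Delta_P$, the geometric median $\mathsf{GM}_K(W)$ is the set of all minimizers over $\xi \in \mathbb{R}^n$ of the function $F_{K,W}(\xi) = \sum_{p \in P} W(p)\,\|\xi - p\|_K$. $\mathsf{conv}(P)$ is the convex hull of $P$. The body $K$ is called intuitive if for every finite non-empty $P \subset \mathbb{R}^n$ and every $W \in \Delta_P$ one has $\mathsf{GM}_K(W) \cap \mathsf{conv}(P) \neq \emptyset$. An ellipsoid is the image of the closed Euclidean unit ball of $\mathbb{R}^n$ under an invertible affine map (for symmetric $K$ it is necessarily centered at the origin, i.e. the image of the ball under an invertible linear map). *)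

(* Defs.v *)
From HB Require Import structures.
From mathcomp Require Import all_boot all_order all_algebra finmap.
From mathcomp Require Import all_classical all_reals.
From mathcomp Require Import topology normedtype convex.

Set Implicit Arguments.
Unset Strict Implicit.
Unset Printing Implicit Defensive.

Import Order.TTheory GRing.Theory Num.Theory.
Import numFieldTopology.Exports numFieldNormedType.Exports.

Local Open Scope classical_set_scope.
Local Open Scope ring_scope.

(* R^n is the space 'rV[R]_n of row vectors; compactness and interior refer to
   its library topology, which is that of the maximum norm, hence the usual
   Euclidean one. *)

Definition symmetric_convex_body (R : realType) (n : nat) (K : set 'rV[R]_n) :=
  [/\ compact K, convex_set K, K° !=set0 & K = [set - x | x in K]].

Definition body_norm (R : realType) (n : nat) (K : set 'rV[R]_n)
    (xi : 'rV[R]_n) : R :=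
  inf [set t : R | 0 < t /\ [set t *: x | x in K] xi].

(* A distribution on P is given by a weight function on the whole space; its
   values outside P are never used. *)
Definition distribution_on (R : realType) (n : nat) (P : {fset 'rV[R]_n})
    (W : 'rV[R]_n -> R) :=
  (forall p, p \in P -> 0 <= W p) /\ \sum_(p <- P) W p = 1.

Definition weighted_dist (R : realType) (n : nat) (K : set 'rV[R]_n)
    (P : {fset 'rV[R]_n}) (W : 'rV[R]_n -> R) (xi : 'rV[R]_n) : R :=
  \sum_(p <- P) W p * body_norm K (xi - p).

Definition geometric_median (R : realType) (n : nat) (K : set 'rV[R]_n)
    (P : {fset 'rV[R]_n}) (W : 'rV[R]_n -> R) : set 'rV[R]_n :=
  [set xi | forall eta, weighted_dist K P W xi <= weighted_dist K P W eta].

Definition convex_hull (R : realType) (n : nat) (A : set 'rV[R]_n) :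
    set 'rV[R]_n :=
  smallest (@convex_set R 'rV[R]_n) A.

Definition intuitive (R : realType) (n : nat) (K : set 'rV[R]_n) :=
  forall (P : {fset 'rV[R]_n}) (W : 'rV[R]_n -> R),
    P != fset0 -> distribution_on P W ->
    geometric_median K P W `&` convex_hull [set` P] !=set0.

Definition euclidean_norm (R : realType) (n : nat) (x : 'rV[R]_n) : R :=
  Num.sqrt (\sum_(i < n) x ord0 i ^+ 2).

Definition ellipsoid (R : realType) (n : nat) (K : set 'rV[R]_n) :=
  exists (A : 'M[R]_n) (c : 'rV[R]_n), A \in unitmx /\
    K = [set x *m A + c | x in [set x | euclidean_norm x <= 1]].

(* Main.v *)
(* Let N be the norm of K.  If for some plane H and v outside H no q in H were
   at most as far from every p in H as v is, then compactness and a minimax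
   argument would produce weights on a finite part of H for which v is better
   than every point of H by a fixed margin, against intuitiveness.  So for each
   plane H the projection onto H along some direction y (namely v - q) has norm
   one, i.e. N h <= N (h + t y) on H.

   At a point x0 where the ball of N touches an inscribed Euclidean sphere, the
   directions belonging to the planes through x0 all lie in the tangent plane
   f^perp.  All sections of the ball parallel to f^perp then have the same
   support directions, so they are homothetic, and the linear reflection fixing
   f^perp and reversing x0 preserves N.  Such x0 are dense.

   Finally, choose B of maximal determinant with |x B| <= N x.  Maximality
   forces these reflections to be orthogonal for |x B|; using those with x0
   close to x - y, N x = N y whenever |x B| = |y B|.  Hence N is proportional
   to |x B|. *)

Require Import Defs.
From mathcomp Require Import all_boot all_order all_algebra.
From mathcomp Require Import all_classical all_reals.
From mathcomp Require Import finmap topology normedtype convex derive interval_inference.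
From mathcomp Require Import ring lra.

Set Implicit Arguments.
Unset Strict Implicit.
Unset Printing Implicit Defensive.

Import Order.TTheory GRing.Theory Num.Theory.
Import numFieldTopology.Exports numFieldNormedType.Exports.

Local Open Scope classical_set_scope.
Local Open Scope ring_scope.

Local Notation i0 := (0 : 'I_3).
Local Notation i1 := (1 : 'I_3).
Local Notation i2 := (2%:R : 'I_3).

(** * Dot and cross products in three coordinates *)

Definition dot (R : comPzRingType) (x y : 'rV[R]_3) : R :=
  x 0 i0 * y 0 i0 + x 0 i1 * y 0 i1 + x 0 i2 * y 0 i2.

Definition row3 (R : comPzRingType) (a b c : R) : 'rV[R]_3 :=
  \row_(i < 3) [:: a; b; c]`_i.

Definition cross (R : comPzRingType) (x y : 'rV[R]_3) : 'rV[R]_3 :=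
  row3 (x 0 i1 * y 0 i2 - x 0 i2 * y 0 i1)
       (x 0 i2 * y 0 i0 - x 0 i0 * y 0 i2)
       (x 0 i0 * y 0 i1 - x 0 i1 * y 0 i0).

Lemma sum3 (V : nmodType) (F : 'I_3 -> V) :
  \sum_(i < 3) F i = F i0 + F i1 + F i2.
Proof.
rewrite !big_ord_recr big_ord0 /= add0r.
by congr (F _ + F _ + F _); apply: val_inj.
Qed.

Lemma row3P (R : pzRingType) (x y : 'rV[R]_3) :
  x 0 i0 = y 0 i0 -> x 0 i1 = y 0 i1 -> x 0 i2 = y 0 i2 -> x = y.
Proof.
move=> e0 e1 e2; apply/rowP => -[[|[|[|//]]]] lt_i3.
- by rewrite (_ : Ordinal _ = i0) //; apply: val_inj.
- by rewrite (_ : Ordinal _ = i1) //; apply: val_inj.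
- by rewrite (_ : Ordinal _ = i2) //; apply: val_inj.
Qed.

Section Dot.
Context {R : realType}.
Implicit Types x y z : 'rV[R]_3.

Lemma dotC x y : dot x y = dot y x.
Proof. by rewrite /dot; ring. Qed.

Lemma dotDl x y z : dot (x + y) z = dot x z + dot y z.
Proof. by rewrite /dot !mxE; ring. Qed.

Lemma dotZl a x z : dot (a *: x) z = a * dot x z.
Proof. by rewrite /dot !mxE; ring. Qed.

Lemma dotNl x z : dot (- x) z = - dot x z.
Proof. by rewrite /dot !mxE; ring. Qed.

Lemma dotDr z x y : dot z (x + y) = dot z x + dot z y.
Proof. by rewrite /dot !mxE; ring. Qed.

Lemma dotZr a z x : dot z (a *: x) = a * dot z x.
Proof. by rewrite /dot !mxE; ring. Qed.

Lemma dotNr z x : dot z (- x) = - dot z x.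
Proof. by rewrite /dot !mxE; ring. Qed.

Definition dotE := (dotDl, dotZl, dotNl, dotDr, dotZr, dotNr).

Lemma dot_ge0 x : 0 <= dot x x.
Proof. by rewrite /dot -!expr2 !addr_ge0 ?sqr_ge0. Qed.

Lemma dot_eq0 x : (dot x x == 0) = (x == 0).
Proof.
apply/idP/eqP => [|->]; last by rewrite /dot !mxE !mulr0 !addr0.
rewrite /dot -!expr2 !paddr_eq0 ?addr_ge0 ?sqr_ge0 // !sqrf_eq0.
by move=> /andP[/andP[/eqP e0 /eqP e1] /eqP e2]; apply: row3P; rewrite mxE.
Qed.

Lemma dot_gt0 x : (0 < dot x x) = (x != 0).
Proof. by rewrite lt_def dot_ge0 dot_eq0 andbT. Qed.

Lemma dot_crossl x y : dot x (cross x y) = 0.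
Proof. by rewrite /dot !mxE /=; ring. Qed.

Lemma dot_crossr x y : dot y (cross x y) = 0.
Proof. by rewrite /dot !mxE /=; ring. Qed.

Lemma cross_crossr x y z : cross x (cross y z) = dot x z *: y - dot x y *: z.
Proof. by apply: row3P; rewrite /dot !mxE /=; ring. Qed.

Lemma crossDr x y z : cross x (y + z) = cross x y + cross x z.
Proof. by apply: row3P; rewrite !mxE /=; ring. Qed.

Lemma crossDl x y z : cross (x + y) z = cross x z + cross y z.
Proof. by apply: row3P; rewrite !mxE /=; ring. Qed.

Lemma crossZr a x y : cross x (a *: y) = a *: cross x y.
Proof. by apply: row3P; rewrite !mxE /=; ring. Qed.

Lemma crossZl a x y : cross (a *: x) y = a *: cross x y.
Proof. by apply: row3P; rewrite !mxE /=; ring. Qed.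

Lemma crossxx x : cross x x = 0.
Proof. by apply: row3P; rewrite !mxE /=; ring. Qed.

Lemma crossC x y : cross x y = - cross y x.
Proof. by apply: row3P; rewrite !mxE /=; ring. Qed.

Lemma cross0l y : cross 0 y = 0.
Proof. by apply: row3P; rewrite !mxE /=; ring. Qed.

Lemma cross_eq0_colinear x y : x != 0 -> cross x y = 0 -> exists k, y = k *: x.
Proof.
move=> x0 xy; exists (dot x y / dot x x).
have := cross_crossr x x y; rewrite xy (_ : cross x 0 = 0); last first.
  by apply: row3P; rewrite !mxE /=; ring.
move/esym/eqP; rewrite subr_eq0 => /eqP e.
by rewrite mulrC -scalerA e scalerA mulVf ?scale1r // dot_eq0.
Qed.

(** The coordinates of [c] along [a], [b] and [n = cross a b] are given by dot and cross products.
    Since [a] and [b] are orthogonal to [f], [n] is a multiple of [f], so the component along [n]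
    vanishes. *)
Lemma plane_decomp (f a b c : 'rV[R]_3) : f != 0 -> dot f a = 0 -> dot f b = 0 ->
  dot f c = 0 -> cross a b != 0 -> exists k l, c = k *: a + l *: b.
Proof.
move=> f0 fa fb fc n0; pose n := cross a b.
have cn : dot c n = 0.
  have [k ->] : exists k, n = k *: f.
    by apply: cross_eq0_colinear => //; rewrite cross_crossr fa fb !scale0r subr0.
  by rewrite dotZr dotC fc mulr0.
have nn : dot n n != 0 by rewrite dot_eq0.
exists (dot (cross c b) n / dot n n), (dot (cross a c) n / dot n n).
have : dot n n *: c = dot (cross c b) n *: a + dot (cross a c) n *: b + dot c n *: n.
  by apply: row3P; rewrite /dot !mxE /=; ring.
rewrite cn scale0r addr0 => e.
by rewrite ![_ / _]mulrC -!scalerA -scalerDr -e scalerA mulVf ?scale1r.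
Qed.

(** Lagrange's identity: the defect is [dot x y ^+ 2]. *)
Lemma cross_cauchy x y : dot (cross x y) (cross x y) <= dot x x * dot y y.
Proof.
rewrite (_ : dot (cross x y) _ = dot x x * dot y y - dot x y ^+ 2).
  by rewrite gerBl sqr_ge0.
by rewrite /dot !mxE /=; ring.
Qed.

Local Notation en := (@euclidean_norm R 3).

Lemma enE x : en x = Num.sqrt (dot x x).
Proof. by rewrite /euclidean_norm /dot sum3 !expr2. Qed.

Lemma en_ge0 x : 0 <= en x.
Proof. exact: sqrtr_ge0. Qed.

Lemma sqr_en x : en x ^+ 2 = dot x x.
Proof. by rewrite enE sqr_sqrtr ?dot_ge0. Qed.

Lemma enZ a x : en (a *: x) = `|a| * en x.
Proof. by rewrite !enE dotZl dotZr mulrA -expr2 sqrtrM ?sqr_ge0 // sqrtr_sqr. Qed.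

Lemma enN x : en (- x) = en x.
Proof. by rewrite -scaleN1r enZ normrN1 mul1r. Qed.

Lemma en_gt0 x : (0 < en x) = (x != 0).
Proof. by rewrite enE sqrtr_gt0 dot_gt0. Qed.

Lemma en_le_norm x : en x <= 2 * `|x|.
Proof.
have xi i : x 0 i ^+ 2 <= `|x| ^+ 2.
  rewrite -real_normK ?num_real // ler_pXn2r ?nnegrE //.
  by rewrite [leRHS]/Num.norm /= mx_normrE; apply: (le_bigmax _ _ (0, i)).
rewrite enE -[leRHS]ger0_norm ?mulr_ge0 // -sqrtr_sqr ler_sqrt ?sqr_ge0 //.
by rewrite exprMn /dot -!expr2; have := xi i0; have := xi i1; have := xi i2;
  have := sqr_ge0 `|x|; lra.
Qed.

End Dot.

(** * Norms on row vectors, equivalent to the maximum norm *)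

Record is_norm (R : realType) (n : nat) (N : 'rV[R]_n -> R) := IsNorm {
  is_normD : forall x y, N (x + y) <= N x + N y;
  is_normZ : forall a x, N (a *: x) = `|a| * N x;
  is_norm_ub : exists2 C, 0 < C & forall x, N x <= C * `|x|;
  is_norm_lb : exists2 D, 0 < D & forall x, `|x| <= D * N x }.

Section NormTheory.
Context {R : realType} {n : nat} {N : 'rV[R]_n -> R} (HN : is_norm N).
Implicit Types x y z : 'rV[R]_n.

Lemma is_norm0 : N 0 = 0.
Proof. by rewrite -(scale0r 0) is_normZ // normr0 mul0r. Qed.

Lemma is_normN x : N (- x) = N x.
Proof. by rewrite -scaleN1r is_normZ // normrN1 mul1r. Qed.

Lemma is_norm_ge0 x : 0 <= N x.
Proof.
case: (is_norm_lb HN) => D D0 /(_ x) xD.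
by rewrite -(pmulr_rge0 _ D0) (le_trans _ xD).
Qed.

Lemma is_norm_eq0 x : N x = 0 -> x = 0.
Proof.
case: (is_norm_lb HN) => D D0 /(_ x) xD x0.
by apply/eqP; rewrite -normr_le0 (le_trans xD) // x0 mulr0.
Qed.

Lemma is_norm_gt0 x : x != 0 -> 0 < N x.
Proof.
move=> x0; rewrite lt_def is_norm_ge0 andbT.
by apply: contra x0 => /eqP/is_norm_eq0 ->.
Qed.

Lemma is_normBC x y : N (x - y) = N (y - x).
Proof. by rewrite -is_normN opprB. Qed.

Lemma is_normB x y : N x - N y <= N (x - y).
Proof. by rewrite lerBlDr (le_trans _ (is_normD HN _ _)) // subrK. Qed.

Lemma is_norm_continuous : continuous N.
Proof.
case: (is_norm_ub HN) => C C0 ub x.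
apply/(@cvgrPdist_le _ _ _ (nbhs x) (nbhs_filter x)) => e e0.
apply/nbhs_ballP; exists (e / C); first exact: divr_gt0.
move=> y; rewrite -ball_normE => /ltW xy /=.
rewrite ler_norml lerNl opprB (le_trans (is_normB _ _)) ?(le_trans (is_normB _ _)) //.
  by rewrite (le_trans (ub _)) // mulrC -ler_pdivlMr.
by rewrite is_normBC (le_trans (ub _)) // mulrC -ler_pdivlMr.
Qed.

End NormTheory.

(** * The gauge of a symmetric convex body *)

Section BodyNorm.
Context {R : realType} {n : nat} {K : set 'rV[R]_n}.
Hypothesis bodyK : symmetric_convex_body K.
Local Notation N := (body_norm K).
Implicit Types x y z : 'rV[R]_n.

Let convK x y (a b : R) : 0 <= a -> 0 <= b -> a + b = 1 -> K x -> K y ->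
  K (a *: x + b *: y).
Proof.
move=> a0 b0 ab Kx Ky; case: bodyK => _ cvx _ _.
have a1 : a <= 1 by rewrite -ab lerDl.
have /set_mem := cvx x y (Itv01 a0 a1) (mem_set Kx) (mem_set Ky).
by rewrite (_ : b = 1 - a) // -ab addrC addKr.
Qed.

Let oppK x : K x -> K (- x).
Proof. by move=> Kx; case: bodyK => _ _ _ ->; exists x. Qed.

(** By symmetry [x] is the midpoint of two points of [K], [c + x] and [- (c - x)], so a ball around
    the interior point [c] can be recentered at the origin. *)
Let ballK : exists2 e, 0 < e & forall x, `|x| < e -> K x.
Proof.
case: (bodyK) => _ _ [c] /nbhs_ballP[e /= e0 ce] _.
exists e => // x xe.
have Kp : K (c + x) by apply: ce; rewrite -ball_normE /= opprD addrA subrr sub0r normrN.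
have Km : K (- (c - x)).
  by apply/oppK/ce; rewrite -ball_normE /= opprB addrC subrK.
rewrite (_ : x = 2^-1 *: (c + x) + 2^-1 *: - (c - x)).
  by apply: convK => //; rewrite ?invr_ge0 //; lra.
rewrite -scalerDr opprB [c + x]addrC addrACA subrr addr0 -mulr2n -(scaler_nat 2 x) scalerA.
by rewrite mulVf ?scale1r // pnatr_eq0.
Qed.

Let gauge x := [set t : R | 0 < t /\ [set t *: y | y in K] x].

Let gaugeP x t : gauge x t <-> 0 < t /\ K (t^-1 *: x).
Proof.
split=> -[t0]; first by move=> [y Ky <-]; rewrite scalerA mulVf ?gt_eqF // scale1r.
by move=> Kx; split=> //; exists (t^-1 *: x) => //;
  rewrite scalerA divff ?gt_eqF // scale1r.
Qed.

Let gauge_ge0 x : lbound (gauge x) 0.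
Proof. by move=> t /= [/ltW]. Qed.

Let gauge_le x t : gauge x t -> N x <= t.
Proof. by move=> xt; apply: ge_inf => //; exists 0; exact: gauge_ge0. Qed.

Let K0 : K 0.
Proof. by case: ballK => e e0; apply; rewrite normr0. Qed.

(** The factor 2 puts the rescaled vector strictly inside the ball. The origin is excluded because
    the gauge set has positive elements only. *)
Let gauge_ub : exists2 C, 0 < C & forall x, x != 0 -> gauge x (C * `|x|).
Proof.
case: ballK => e e0 eK; exists (2 / e); first by rewrite divr_gt0.
move=> x x0; have x_gt0 : 0 < `|x| by rewrite normr_gt0.
have Cx : 0 < 2 / e * `|x| by rewrite mulr_gt0 // divr_gt0.
apply/gaugeP; split=> //; apply: eK.
rewrite normrZ gtr0_norm ?invr_gt0 // invfM -mulrA mulVf ?gt_eqF // mulr1.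
by rewrite invf_div ltr_pdivrMr // ltr_pMr // ltr1n.
Qed.

Let gauge_neq0 x : gauge x !=set0.
Proof.
have [->|x0] := eqVneq x 0; first by exists 1; apply/gaugeP; rewrite scaler0.
by case: gauge_ub => C _ /(_ x x0); exists (C * `|x|).
Qed.

(** [K] is star-shaped about 0, so the gauge set is closed upwards. *)
Let gauge_gt x t : N x < t -> gauge x t.
Proof.
move=> xt; have [s xs st] : exists2 s, gauge x s & s < t.
  by apply: inf_lt => //; exact: gauge_neq0.
have [s0 Ks] := (gaugeP x s).1 xs; have t0 := lt_trans s0 st.
apply/gaugeP; split=> //.
rewrite (_ : t^-1 *: x = (s / t) *: (s^-1 *: x) + (1 - s / t) *: 0); last first.
  by rewrite scaler0 addr0 scalerA mulrAC divff ?mul1r // gt_eqF.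
apply: convK => //; last by rewrite addrC subrK.
  by rewrite divr_ge0 // ltW.
by rewrite subr_ge0 ler_pdivrMr // mul1r ltW.
Qed.

Let N_ge0 x : 0 <= N x.
Proof. by apply: lb_le_inf; [exact: gauge_neq0 | exact: gauge_ge0]. Qed.

Let N0 : N 0 = 0.
Proof.
apply/eqP; rewrite eq_le N_ge0 andbT; apply/ler_addgt0Pl => e e0.
by rewrite addr0; apply: gauge_le; apply/gaugeP; rewrite scaler0.
Qed.

Let NZ_le a x : 0 < a -> N (a *: x) <= a * N x.
Proof.
move=> a0; apply/ler_addgt0Pl => e e0.
have : gauge x (N x + e / a) by apply: gauge_gt; rewrite ltrDl divr_gt0.
case/gaugeP => t0 Kx; rewrite (_ : e + _ = a * (N x + e / a)); last first.
  by rewrite mulrDr mulrCA divff ?gt_eqF // mulr1 addrC.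
apply/gauge_le/gaugeP; split; first exact: mulr_gt0.
by rewrite invfM scalerA mulrAC mulVf ?mul1r ?gt_eqF.
Qed.

Let NN_le x : N (- x) <= N x.
Proof.
apply/ler_addgt0Pl => e e0.
have /gaugeP[t0 Kx] : gauge x (e + N x) by apply: gauge_gt; rewrite ltrDr.
by apply/gauge_le/gaugeP; split=> //; rewrite scalerN; exact: oppK.
Qed.

Lemma body_norm_is_norm : is_norm N.
Proof.
split=> [x y|a x||].
- apply/ler_addgt0Pl => e e0; have e20 : 0 < e / 2 by rewrite divr_gt0.
  have /gaugeP[s0 Ks] : gauge x (N x + e / 2) by apply: gauge_gt; rewrite ltrDl.
  have /gaugeP[t0 Kt] : gauge y (N y + e / 2) by apply: gauge_gt; rewrite ltrDl.
  set s := _ + _ in s0 Ks; set t := _ + _ in t0 Kt.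
  rewrite (_ : e + _ = s + t); last by rewrite /s /t; field.
  have st0 : 0 < s + t by rewrite addr_gt0.
  apply/gauge_le/gaugeP; split=> //.
  rewrite (_ : _ *: _ = (s / (s + t)) *: (s^-1 *: x) + (t / (s + t)) *: (t^-1 *: y)).
    apply: convK => //; rewrite ?divr_ge0 ?ltW //.
    by rewrite -mulrDl divff // gt_eqF.
  rewrite !scalerA !(mulrAC _ (s + t)^-1) !divff ?gt_eqF //.
  by rewrite !mul1r -scalerDr.
- have pos b z : 0 < b -> N (b *: z) = b * N z.
    move=> b0; apply/eqP; rewrite eq_le NZ_le //=.
    rewrite mulrC -ler_pdivlMr // mulrC.
    have := @NZ_le b^-1 (b *: z); rewrite invr_gt0 => /(_ b0).
    by rewrite scalerA mulVf ?gt_eqF // scale1r.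
  have NN z : N (- z) = N z.
    by apply/eqP; rewrite eq_le NN_le -{1}[z]opprK NN_le.
  have [a0|a0|->] := ltgtP a 0; last by rewrite scale0r N0 normr0 mul0r.
  + by rewrite -NN -scaleNr pos ?oppr_gt0 // ltr0_norm.
  + by rewrite pos // gtr0_norm.
- case: gauge_ub => C C0 CK; exists C => // x.
  have [->|x0] := eqVneq x 0; first by rewrite N0 normr0 mulr0.
  exact/gauge_le/CK.
- case: bodyK => /compact_bounded[M [_ MK]] _ _ _.
  have M0 : 0 < `|M| + 1 by rewrite ltr_wpDl.
  have {}MK x : K x -> `|x| <= `|M| + 1.
    by apply: MK; rewrite (le_lt_trans (ler_norm _)) // ltrDl.
  exists (`|M| + 1) => // x.
  rewrite mulrC -ler_pdivrMr //; apply/ler_addgt0Pl => e e0.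
  have /gaugeP[t0 /MK] : gauge x (e + N x) by apply: gauge_gt; rewrite ltrDr.
  by rewrite normrZ gtr0_norm ?invr_gt0 // mulrC !ler_pdivrMr // mulrC.
Qed.

(** Closedness of [K] gives the harder inclusion: if [N x <= 1], the points [(1 + d)^-1 *: x] lie in
    [K] and tend to [x] with [d] to 0. *)
Lemma body_norm_ballE : K = [set x | N x <= 1].
Proof.
apply/seteqP; split=> x /= Kx.
  by apply/gauge_le/gaugeP; rewrite invr1 scale1r.
have [/compact_closed clK _ _ _] := bodyK.
have {}clK : closed K by apply: clK; exact: norm_hausdorff.
apply: clK => B /nbhs_ballP[e /= e0 eB].
have x0 : 0 < `|x| + 1 by rewrite ltr_wpDl.
pose d := e / (`|x| + 1); have d0 : 0 < d by rewrite divr_gt0.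
have d1 : 0 < 1 + d by rewrite addr_gt0.
exists ((1 + d)^-1 *: x); split.
  have /gaugeP[] // : gauge x (1 + d) by apply: gauge_gt; rewrite (le_lt_trans Kx) // ltrDl.
apply: eB; rewrite -ball_normE /= -{1}[x]scale1r -scalerBl normrZ.
rewrite (_ : 1 - _ = d / (1 + d)); last by field; rewrite gt_eqF.
rewrite gtr0_norm ?divr_gt0 // mulrAC ltr_pdivrMr // /d mulrAC ltr_pdivrMr //.
rewrite -mulrA ltr_pM2l // (@lt_le_trans _ _ (`|x| + 1)) ?ltrDl //.
by rewrite ler_peMl // ?lerDl ltW.
Qed.

End BodyNorm.

(** * A minimax theorem for finitely many convex functions *)

Section Minimax.
Context {R : realType} {V : lmodType R}.
Implicit Types (X : set V) (f g : V -> R).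

Definition cvx_dom X := forall x y (a b : R), 0 <= a -> 0 <= b -> a + b = 1 ->
  X x -> X y -> X (a *: x + b *: y).

Definition cvx_on X f := forall x y (a b : R), 0 <= a -> 0 <= b -> a + b = 1 ->
  X x -> X y -> f (a *: x + b *: y) <= a * f x + b * f y.

(** A point [w] with [g w < 0] forces [l] to be at least [r w]; a point [u] with [f u < 0] forces it
    to be at most [g u / (g u - f u)]. By [key] these constraints are compatible, and [l] is the
    supremum of the lower ones. *)
Lemma minimax2 X f g : cvx_dom X -> cvx_on X f -> cvx_on X g ->
  (forall x, X x -> 0 <= f x \/ 0 <= g x) ->
  exists l, [/\ 0 <= l, l <= 1 & forall x, X x -> 0 <= l * f x + (1 - l) * g x].
Proof.
move=> cX cf cg fg.
have [[x [Xx fx]]|nf] := pselect (exists x, X x /\ f x < 0); last first.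
  exists 1; split=> // z Xz; rewrite mul1r subrr mul0r addr0 leNgt.
  by apply/negP => fz; apply: nf; exists z.
have [[y [Xy gy]]|ng] := pselect (exists y, X y /\ g y < 0); last first.
  exists 0; split=> // z Xz; rewrite mul0r subr0 mul1r add0r leNgt.
  by apply/negP => gz; apply: ng; exists z.
(* Otherwise [f] and [g] would both be negative at the point of the segment from [u] to [w] where
   their linear interpolations agree. *)
have key u w : X u -> X w -> f u < 0 -> g w < 0 -> g w * f u <= g u * f w.
  move=> Xu Xw fu gw; rewrite leNgt; apply/negP => lt_gf.
  have gu : 0 <= g u by case: (fg u Xu) => //; rewrite leNgt fu.
  have fw : 0 <= f w by case: (fg w Xw) => //; rewrite [0 <= g w]leNgt gw.
  pose s := (f w - g w) + (g u - f u).
  have s0 : 0 < s by rewrite /s; lra.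
  have a0 : 0 <= (f w - g w) / s by rewrite divr_ge0 ?ltW //; lra.
  have b0 : 0 <= (g u - f u) / s by rewrite divr_ge0 ?ltW //; lra.
  have ab : (f w - g w) / s + (g u - f u) / s = 1 by rewrite -mulrDl divff // gt_eqF.
  have := cf _ _ _ _ a0 b0 ab Xu Xw; have := cg _ _ _ _ a0 b0 ab Xu Xw.
  have -> : (f w - g w) / s * g u + (g u - f u) / s * g w = (g u * f w - g w * f u) / s.
    by field; rewrite gt_eqF.
  have -> : (f w - g w) / s * f u + (g u - f u) / s * f w = (g u * f w - g w * f u) / s.
    by field; rewrite gt_eqF.
  have neg : (g u * f w - g w * f u) / s < 0.
    by rewrite pmulr_llt0 ?invr_gt0 // subr_lt0.
  move=> /le_lt_trans/(_ neg) g0 /le_lt_trans/(_ neg) f0.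
  by case: (fg _ (cX _ _ _ _ a0 b0 ab Xu Xw)); rewrite leNgt ?f0 ?g0.
pose r w := - g w / (f w - g w); pose L := [set r w | w in [set w | X w /\ g w < 0]].
have rle w c : X w -> g w < 0 -> (r w <= c) = (0 <= c * f w + (1 - c) * g w).
  move=> Xw gw; have fw : 0 <= f w by case: (fg w Xw) => //; rewrite [0 <= g w]leNgt gw.
  rewrite /r ler_pdivrMr; last by lra.
  by rewrite -subr_ge0; congr (0 <= _); ring.
have ubL u : X u -> f u < 0 -> ubound L (g u / (g u - f u)).
  move=> Xu fu _ [w [Xw gw] <-]; rewrite rle //.
  have gu : 0 <= g u by case: (fg u Xu) => //; rewrite leNgt fu.
  have d0 : 0 < g u - f u by lra.
  rewrite (_ : _ + _ = (g u * f w - g w * f u) / (g u - f u)); last first.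
    by field; rewrite gt_eqF.
  by rewrite divr_ge0 ?(ltW d0) // subr_ge0 key.
have supL : has_sup L.
  by split; [exists (r y); exists y | exists (g x / (g x - f x)); apply: ubL].
have r_sup w : X w -> g w < 0 -> r w <= sup L.
  by move=> Xw gw; apply: ub_le_sup; [case: supL | exists w].
have sup0 : 0 <= sup L.
  have fy : 0 <= f y by case: (fg y Xy) => //; rewrite [0 <= g y]leNgt gy.
  by apply: le_trans (r_sup _ Xy gy); rewrite divr_ge0 //; lra.
have sup1 : sup L <= 1.
  apply: ge_sup; first by case: supL.
  move=> _ [w [Xw gw] <-]; rewrite rle // subrr mul0r addr0 mul1r.
  by case: (fg w Xw) => //; rewrite [0 <= g w]leNgt gw.
exists (sup L); split=> // z Xz.
have [fz|fz] := ltP (f z) 0.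
  have gz : 0 <= g z by case: (fg z Xz) => //; rewrite leNgt fz.
  have : sup L <= g z / (g z - f z) by apply: ge_sup; [case: supL | exact: ubL].
  rewrite ler_pdivlMr; last by lra.
  by rewrite -subr_ge0; congr (0 <= _); ring.
have [gz|gz] := ltP (g z) 0; first by rewrite -rle // r_sup.
by rewrite addr_ge0 // mulr_ge0 // subr_ge0.
Qed.

(** Induction on [s]: where [f p] is negative some other function is not, so the induction
    hypothesis on that convex subset gives weights for the tail. Then [minimax2] combines [f p] with
    the weighted sum of the tail. *)
Lemma minimax (I : eqType) (f : I -> V -> R) (s : seq I) X : uniq s -> X !=set0 ->
  cvx_dom X -> (forall p, cvx_on X (f p)) ->
  (forall x, X x -> exists2 p, p \in s & 0 <= f p x) ->
  exists W : I -> R, [/\ forall p, p \in s -> 0 <= W p, \sum_(p <- s) W p = 1 &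
    forall x, X x -> 0 <= \sum_(p <- s) W p * f p x].
Proof.
elim: s X => [|p s IH] X /= => [_ [x Xx] _ _ /(_ x Xx) [] //|/andP[ps us] X0 cX cf fs].
have [X'0|X'0] := pselect ((X `&` [set x | f p x < 0]) !=set0); last first.
  exists (fun q => (q == p)%:R); split=> [q _||x Xx]; first exact: ler0n.
    rewrite big_cons eqxx big1_seq ?addr0 // => q /andP[_ qs].
    by case: eqP qs => // ->; rewrite (negPf ps).
  rewrite big_cons eqxx mul1r big1_seq ?addr0 => [|q /andP[_ qs]].
    by rewrite leNgt; apply/negP => fx; apply: X'0; exists x.
  by case: eqP qs => [->|_ _]; rewrite ?(negPf ps) // mul0r.
have [|q|x [Xx fx]|W [W0 W1 Wf]] := IH _ us X'0.
- move=> x y a b a0 b0 ab [Xx fx] [Xy fy]; split; first exact: cX.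
  rewrite /= (le_lt_trans (cf p _ _ _ _ a0 b0 ab Xx Xy)) //.
  have [a_eq0|an0] := eqVneq a 0.
    by move: ab; rewrite a_eq0 add0r => ->; rewrite mul0r add0r mul1r.
  have {an0}a0 : 0 < a by rewrite lt_def an0.
  by rewrite -[ltRHS]addr0 ltr_leD ?pmulr_rlt0 // mulr_ge0_le0 // ltW.
- by move=> x y a b a0 b0 ab [Xx _] [Xy _]; exact: cf.
- have [r] := fs x Xx; rewrite inE => /predU1P[->|rs]; last by exists r.
  by rewrite leNgt fx.
have [||x Xx|l [l0 l1 lf]] := @minimax2 X (f p) (fun x => \sum_(q <- s) W q * f q x) cX.
- exact: cf.
- move=> x y a b a0 b0 ab Xx Xy; rewrite !mulr_sumr -big_split /=.
  rewrite !big_seq; apply: ler_sum => q qs.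
  by rewrite !(mulrCA _ (W q)) -mulrDr ler_wpM2l ?W0 // cf.
- by have [fx|fx] := ltP (f p x) 0; [right; exact: Wf | left].
exists (fun q => if q == p then l else (1 - l) * W q); split.
- move=> q; rewrite inE; case: eqP => //= _ qs; rewrite mulr_ge0 ?subr_ge0 //; exact: W0.
- rewrite big_cons eqxx (eq_big_seq (fun q => (1 - l) * W q)).
    by rewrite -mulr_sumr W1 mulr1 addrC subrK.
  by move=> q qs; case: eqP qs => // ->; rewrite (negPf ps).
- move=> x /lf; rewrite big_cons eqxx mulr_sumr.
  congr (0 <= _ + _); apply: eq_big_seq => q qs.
  by case: eqP qs => [->|_ _]; rewrite ?(negPf ps) // mulrA.
Qed.

End Minimax.

Lemma closed_le_cont (R : realType) (T : topologicalType) (f : T -> R) c :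
  continuous f -> closed [set x | f x <= c].
Proof. by move=> /continuous_closedP/(_ _ (@closed_le _ c)). Qed.

(** * Norm-one projections onto planes *)

Section Planes.
Context {R : realType} {K : set 'rV[R]_3}.
Local Notation N := (body_norm K).
Hypotheses (HN : is_norm N) (intK : intuitive K).
Implicit Types (g h p q v : 'rV[R]_3).

Let cvx_plane g : cvx_dom [set h | dot g h = 0].
Proof. by move=> x y a b _ _ _ /= gx gy; rewrite !dotE gx gy !mulr0 addr0. Qed.

(** If every point of the plane were farther than [v] by at least [e] from some [p], [minimax] would
    give a distribution for which every point of the plane costs at least [e] more than [v]. A
    median in the convex hull, hence in the plane, excludes this. *)
Let plane_finite g v (P : {fset 'rV[R]_3}) e : 0 < e ->
  (forall p, p \in P -> dot g p = 0) ->
  exists2 q, dot g q = 0 & forall p, p \in P -> N (q - p) <= N (v - p) + e.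
Proof.
move=> e0 gP; apply: contrapT => noq.
have far q : dot g q = 0 -> exists2 p, p \in P & 0 <= N (q - p) - (N (v - p) + e).
  move=> gq; apply: contrapT => nop; apply: noq; exists q => // p pP.
  by rewrite leNgt; apply/negP => lt_q; apply: nop; exists p => //; rewrite subr_ge0 ltW.
have [|p|W [W0 W1 Wge]] := minimax (fset_uniq P) _ (@cvx_plane g) _ far.
- by exists 0; rewrite /= /dot !mxE !mulr0 !addr0.
- move=> x y a b a0 b0 ab _ _.
  rewrite (_ : a *: x + b *: y - p = a *: (x - p) + b *: (y - p)); last first.
    by rewrite !scalerBr addrACA -opprD -scalerDl ab scale1r.
  rewrite (_ : a * _ + _ = a * N (x - p) + b * N (y - p) - (N (v - p) + e)).
    rewrite lerD2r.
    by rewrite (le_trans (is_normD HN _ _)) // !(is_normZ HN) !ger0_norm.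
  by have -> : b = 1 - a; [rewrite -ab addrC addKr | ring].
have P0 : P != fset0.
  by apply/eqP => P0; move: W1; rewrite P0 big_nil => /esym/eqP; rewrite oner_eq0.
have [xi [xiM xiP]] := intK P0 (conj W0 W1).
have gxi : dot g xi = 0.
  apply: (xiP [set h | dot g h = 0]); split; last by move=> p /= /gP.
  move=> x y l /set_mem gx /set_mem gy; apply/mem_set.
  by apply: cvx_plane => //; rewrite ?subr_ge0 // addrC subrK.
have := Wge _ gxi; have := xiM v.
rewrite /weighted_dist -subr_ge0 -sumrB => le_v.
under eq_bigr do rewrite mulrBr mulrDr opprD addrA.
rewrite sumrB -mulr_suml W1 mul1r; under eq_bigr do rewrite -opprB.
by rewrite sumrN; lra.
Qed.

(** The normal [g] itself serves as the point outside the plane. Compactness yields one [q] in the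
    plane satisfying all distance inequalities, and [y] is [g - q]. *)
Lemma plane_projection g : g != 0 ->
  exists2 y, y != 0 & forall h, dot g h = 0 -> forall t, N h <= N (h + t *: y).
Proof.
move=> g0; pose A := [set q : 'rV[R]_3 | dot g q = 0 /\ N q <= N g + 1].
have cont_dot : continuous (dot g).
  have c i : continuous (fun h : 'rV[R]_3 => g 0 i * h 0 i).
    by move=> x; apply: continuousM; [exact: cst_continuous | exact: coord_continuous].
  by move=> x; exact: (continuousD (continuousD (c i0 x) (c i1 x)) (c i2 x)).
have cA : compact A.
  apply: bounded_closed_compact.
    case: (is_norm_lb HN) => D D0 lb; exists (D * (N g + 1)).
    split; first exact: num_real.
    move=> M ltM x [_ xN] /=; rewrite (le_trans (lb x)) // (le_trans _ (ltW ltM)) //.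
    by rewrite ler_pM2l.
  apply: (@closedI _ (dot g @^-1` [set 0]) (N @^-1` [set x | x <= N g + 1])).
    by move/continuous_closedP: cont_dot => /(_ _ (@closed_eq _ 0)).
  exact: closed_le_cont (is_norm_continuous HN).
(* An index [(p, e)] asks that [q] be at most as far from [p] as [g] is, up to [e]; only finitely
   many such constraints need be met at once. *)
pose D := [set i : 'rV[R]_3 * R | dot g i.1 = 0 /\ 0 < i.2].
pose F (i : 'rV[R]_3 * R) := [set q | N (q - i.1) <= N (g - i.1) + i.2].
have g_0 : dot g 0 = 0 by rewrite /dot !mxE !mulr0 !addr0.
have := cA; rewrite compact_In0 => /(_ _ D (fun i => A `&` F i)) [||q qF].
- exists F => // i _.
  have cont : continuous (fun q => N (q - i.1)).
    move=> q; apply: (@continuous_comp _ _ _ (fun q => q - i.1) N).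
      by apply: continuousB; [exact: cvg_id | exact: cst_continuous].
    exact: (is_norm_continuous HN).
  exact: closed_le_cont.
- move=> D' D'D.
  (* One tolerance serves finitely many constraints. It is capped by 1, and 0 is joined to the
     points in [P], so that the [q] found lies in [A]. *)
  have [e [e0 e1 eD]] : exists e, [/\ 0 < e, e <= 1 &
      forall i, i \in enum_fset D' -> e <= i.2].
    have: forall i, i \in enum_fset D' -> 0 < i.2 by move=> i /D'D /set_mem [].
    elim: (enum_fset D') => [_|i s IH sD]; first by exists 1.
    have [|e [e0 e1 es]] := IH; first by move=> j js; apply: sD; rewrite inE js orbT.
    exists (Num.min e i.2); split=> [||j].
    + by rewrite lt_min e0 sD // mem_head.
    + by rewrite ge_min e1.
    + by rewrite inE => /predU1P[->|/es le_ej]; rewrite ge_min ?lexx ?le_ej ?orbT.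
  pose P := (0 |` [fset i.1 | i in D'])%fset.
  have [|q gq qP] := @plane_finite g g P e e0.
    move=> p; rewrite !inE => /orP[/eqP ->//|/imfsetP[i /= iD ->]].
    by have /set_mem[] := D'D _ iD.
  exists q => i /= iD; split.
    split=> //; rewrite -[q]subr0 -[g]subr0 (le_trans (qP _ _)) ?lerD2l //.
    by rewrite !inE eqxx.
  rewrite /F /= (le_trans (qP _ _)) ?lerD2l ?eD //.
  by rewrite !inE in_imfset ?orbT.
have [gq _] : A q by have [] := qF (0, 1) (conj g_0 ltr01).
have qle p : dot g p = 0 -> N (q - p) <= N (g - p).
  move=> gp; apply/ler_addgt0Pr => e e0.
  by have [] := qF (p, e) (conj gp e0).
exists (g - q) => [|h gh t].
  by apply: contra g0 => /eqP/subr0_eq gE; rewrite -dot_eq0 [X in dot _ X]gE gq.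
have [->|t0] := eqVneq t 0; first by rewrite scale0r addr0.
(* With [p = q - t^-1 *: h] in the plane, [h + t *: y] is [t *: (g - p)] and [h] is
   [t *: (q - p)]. *)
rewrite (_ : h + _ = t *: (g - (q - t^-1 *: h))); last first.
  by rewrite opprB addrCA [RHS]scalerDr scalerA divff // scale1r.
rewrite (is_normZ HN).
have -> : N h = `|t| * N (q - (q - t^-1 *: h)).
  by rewrite opprB addrC subrK -(is_normZ HN) scalerA divff // scale1r.
by rewrite ler_wpM2l // qle // !dotE gq gh mulr0 subr0.
Qed.

End Planes.

(** * Points where an inscribed Euclidean sphere touches the ball *)

Section ContactPoints.
Context {R : realType}.
Implicit Types (f x y z w : 'rV[R]_3).

Lemma norm_le_en x : `|x| <= euclidean_norm x.
Proof.
rewrite [leLHS]/Num.norm /= mx_normrE; apply/bigmax_leP; split; first exact: en_ge0.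
move=> [i j] _ /=; rewrite -sqrtr_sqr ler_wsqrtr // (ord1 i).
by rewrite (bigD1 j) //= lerDl sumr_ge0 // => k _; rewrite sqr_ge0.
Qed.

Lemma dist_continuous z : continuous (fun w => dot (w - z) (w - z)).
Proof.
have c i : continuous (fun w => (w - z) 0 i * (w - z) 0 i).
  have ci : continuous (fun w => (w - z) 0 i).
    rewrite (_ : (fun w => _) = (fun w => w 0 i - z 0 i)); last first.
      by apply/funext => w; rewrite !mxE.
    by move=> w; apply: continuousB; [exact: coord_continuous | exact: cst_continuous].
  by move=> w; apply: continuousM; exact: ci.
by move=> w; exact: (continuousD (continuousD (c i0 w) (c i1 w)) (c i2 w)).
Qed.

(** First-order condition for a quadratic in [t] minimal at 0. The test value [- a / (b + 1)]
    replaces the vertex [- a / b] to avoid a zero denominator. *)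
Lemma tangent_orth f y : (forall t : R, dot f f <= dot (f + t *: y) (f + t *: y)) ->
  dot f y = 0.
Proof.
move=> le_f; set a := dot f y; pose b := dot y y.
have b0 : 0 <= b := dot_ge0 y; have b1 : 0 < b + 1 by lra.
have := le_f (- a / (b + 1)).
rewrite !dotE [dot y f]dotC -/a -/b.
set t := - a / (b + 1); have at_ : a = - t * (b + 1) by rewrite /t; field; rewrite gt_eqF.
move=> le_ff; have : t ^+ 2 * (b + 2) <= 0.
  by rewrite at_ in le_ff; move: le_ff; lra.
rewrite pmulr_lle0; last by lra.
rewrite le_eqVlt ltNge sqr_ge0 orbF sqrf_eq0 => /eqP t0.
by rewrite at_ t0 oppr0 mul0r.
Qed.

(* The nearest point x0 of the complement of a ball to a center z inside it lies
   on a Euclidean sphere inscribed in the ball, so that the support plane at x0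
   is unique, with normal x0 - z. *)
Lemma contact_point (N : 'rV[R]_3 -> R) (HN : is_norm N) x (e : R) :
  x != 0 -> 0 < e ->
  exists x0 f, [/\ dot (x0 - x) (x0 - x) <= e, dot f x0 != 0 &
    forall y, (forall t, N x0 <= N (x0 + t *: y)) -> dot f y = 0].
Proof.
move=> xn0 e0; have Nx := is_norm_gt0 HN xn0.
have xx : 0 < dot x x by rewrite dot_gt0.
(* The center [z] is so close to [x] that points no farther from [z] than [x] are within squared
   distance [4 * k ^+ 2 * dot x x] of [x], which is at most [e]. *)
pose k := Num.min 2^-1 (e / (4 * dot x x)).
have k0 : 0 < k by rewrite lt_min invr_gt0 ltr0n divr_gt0 // mulr_gt0.
have k1 : k <= 2^-1 by rewrite ge_min lexx.
have ke : 4 * k * dot x x <= e.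
  by rewrite mulrAC mulrC -ler_pdivlMr ?mulr_gt0 // ge_min lexx orbT.
pose z := (1 - k) *: x.
have Nz : N z < N x.
  by rewrite (is_normZ HN) gtr0_norm ?gtr_pMl //; lra.
pose d w := dot (w - z) (w - z).
(* The complement of the ball, cut off at the distance from [z] to [x] to make it compact. *)
pose A := [set w | N x <= N w /\ d w <= d x].
have cA : compact A.
  apply: bounded_closed_compact.
    exists (Num.sqrt (d x) + `|z|); split; first exact: num_real.
    move=> M ltM w [_ dw] /=; rewrite -[w](subrK z) (le_trans (ler_normD _ _)) //.
    rewrite (le_trans _ (ltW ltM)) // lerD2r (le_trans (norm_le_en _)) //.
    by rewrite enE ler_wsqrtr.
  apply: (@closedI _ [set w | N x <= N w] [set w | d w <= d x]); last first.
    exact/closed_le_cont/dist_continuous.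
  rewrite (_ : [set w | _] = [set w | - N w <= - N x]); last first.
    by apply/funext => w /=; rewrite lerN2.
  apply: closed_le_cont => w; apply: continuousN; exact: (is_norm_continuous HN).
have A0 : A !=set0 by exists x; split.
have [|x0 /set_mem[Nx0 dx0] minx0] := compact_EVT_min A0 cA (f := d).
  by apply: continuous_subspaceT; exact: dist_continuous.
have ball w : d w < d x0 -> N w < N x0.
  move=> ltw; apply: lt_le_trans Nx0; rewrite ltNge; apply/negP => Nw.
  have /mem_set/minx0 : A w by split=> //; rewrite (le_trans (ltW ltw)).
  by rewrite leNgt ltw.
have Nx0_gt0 : 0 < N x0 by exact: lt_le_trans Nx0.
pose f := x0 - z.
have ff : 0 < dot f f.
  rewrite dot_gt0 subr_eq0; apply/eqP => x0z.
  by move: Nx0; rewrite x0z leNgt Nz.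
have dE w t : d (x0 + t *: w) = dot (f + t *: w) (f + t *: w).
  by rewrite /d addrAC.
have dx0E : d x0 = dot f f by [].
have x0E : x0 - x = f - k *: x.
  by rewrite /f /z scalerBl scale1r opprB addrA (addrAC x0) addrK.
exists x0, f; clearbody f; split; rewrite ?x0E.
- have dxE : d x = k ^+ 2 * dot x x.
    rewrite /d /z scalerBl scale1r opprB addrC subrK.
    by rewrite dotZl dotZr mulrA expr2.
  have fk : dot f f <= k ^+ 2 * dot x x by rewrite -dxE -dx0E.
  have := dot_ge0 (f + k *: x); rewrite !dotE [dot x f]dotC => ge0.
  have : k ^+ 2 * dot x x <= k * dot x x.
    by rewrite ler_pM2r // expr2 ger_pMl //; lra.
  by move: fk ge0 ke; lra.
(* If [f] were orthogonal to [x0], a small move from [x0] along [v] would enter the Euclidean ball,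
   as [dot f v < 0]; but with this [M] the triangle inequality forbids [N] to decrease. *)
- apply/eqP => fx0; pose M := N f / N x0; pose v := M *: x0 - f.
  pose t := dot f f / (dot v v + dot f f).
  have vf : 0 < dot v v + dot f f by rewrite ltr_wpDl ?dot_ge0.
  have t0 : 0 < t by rewrite divr_gt0.
  have : N (x0 + t *: v) < N x0.
    have fv : dot f v = - dot f f by rewrite /v !dotE fx0 mulr0 sub0r.
    have tE : t * dot v v = dot f f - t * dot f f.
      by rewrite /t; field; rewrite gt_eqF.
    apply: ball; rewrite dE dx0E; move: (v) fv tE => w fw tE.
    rewrite !dotE [dot w f]dotC fw tE.
    have := mulr_gt0 t0 ff; have := mulr_gt0 t0 (mulr_gt0 t0 ff); lra.
  apply/negP; rewrite -leNgt.
  have -> : x0 + t *: v = (1 + t * M) *: x0 - t *: f.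
    by rewrite /v scalerBr scalerA scalerDl scale1r addrA.
  rewrite (le_trans _ (is_normB HN _ _)) // !(is_normZ HN) (gtr0_norm t0).
  have M0 : 0 <= M by rewrite divr_ge0 // ?is_norm_ge0 ?ltW.
  rewrite ger0_norm; last by rewrite addr_ge0 // mulr_ge0 // ltW.
  by rewrite mulrDl mul1r -mulrA divfK ?gt_eqF // addrK.
- move=> y ley; apply: tangent_orth => t; rewrite -dE -dx0E leNgt.
  by apply/negP => /ball; rewrite ltNge ley.
Qed.

End ContactPoints.

(** * Homothetic sections and the resulting reflection *)

Section Rotation.
Context {R : realType} {N : 'rV[R]_3 -> R} (HN : is_norm N).
Hypothesis proj : forall g, g != 0 ->
  exists2 y, y != 0 & forall h, dot g h = 0 -> forall t, N h <= N (h + t *: y).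
Context {x0 f : 'rV[R]_3} (fx0 : dot f x0 != 0).
Hypothesis tangent : forall y, (forall t, N x0 <= N (x0 + t *: y)) -> dot f y = 0.
Implicit Types u b y : 'rV[R]_3.

Let f0 : f != 0.
Proof. by apply: contra fx0 => /eqP ->; rewrite /dot !mxE !mul0r !addr0. Qed.

(* The direction of projection onto the plane spanned by u and x0 lies in the
   tangent plane f^perp; that a serves for all l says that the sections of the
   ball parallel to f^perp share their support directions. *)
Lemma common_support u b : dot f u = 0 -> dot f b = 0 -> cross u b != 0 ->
  exists a, forall d l, N ((1 + a * d) *: u + l *: x0) <= N (u + d *: b + l *: x0).
Proof.
move=> fu fb ub.
have u0 : u != 0 by apply: contra ub => /eqP ->; rewrite cross0l.
pose g := cross u x0.
have g0 : g != 0.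
  apply: contra u0 => /eqP g0.
  have := cross_crossr f u x0; rewrite -/g g0 fu scale0r subr0 crossC cross0l oppr0.
  by move/esym/eqP; rewrite scaler_eq0 (negPf fx0).
have gu : dot g u = 0 by rewrite dotC dot_crossl.
have gx0 : dot g x0 = 0 by rewrite dotC dot_crossr.
have [y y0 yP] := proj g0.
have fy : dot f y = 0 by apply: tangent; exact: yP.
(* If [y] were parallel to [u] it would lie in the plane projected onto, and the case [h = y],
   [t = -1] would give [N y <= 0]. *)
have uy : cross u y != 0.
  apply: contra y0 => /eqP uy; have [k yE] := cross_eq0_colinear u0 uy.
  have : N y <= N (y + -1 *: y) by apply: yP; rewrite yE dotZr gu mulr0.
  rewrite scaleN1r subrr (is_norm0 HN) => y_le0.
  by apply/eqP/(is_norm_eq0 HN)/eqP; rewrite eq_le y_le0 (is_norm_ge0 HN).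
(* The projection removes the component of [b] along [y]; the remaining coefficient [a] does not
   involve [l]. *)
have [a [c bE]] := plane_decomp f0 fu fy fb uy.
exists a => d l.
have -> : u + d *: b + l *: x0 = (1 + a * d) *: u + l *: x0 + (d * c) *: y.
  by rewrite bE; apply: row3P; rewrite !mxE; ring.
by apply: yP; rewrite !dotE gu gx0 !mulr0 addr0.
Qed.

(** The Euclidean distance from the origin to the line is the length of [cross u b] divided by that
    of [b]; [D] turns it into a bound on [N]. *)
Lemma chord_lower_bound u b : cross u b != 0 ->
  exists2 m, 0 < m & forall t, m <= N (u + t *: b).
Proof.
move=> ub; have [D D0 lb] := is_norm_lb HN.
have b0 : b != 0 by apply: contra ub => /eqP ->; rewrite crossC cross0l oppr0.
exists (euclidean_norm (cross u b) / euclidean_norm b / (2 * D)).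
  by rewrite divr_gt0 ?divr_gt0 ?en_gt0 // mulr_gt0.
move=> t; rewrite ler_pdivrMr ?mulr_gt0 // ler_pdivrMr ?en_gt0 //.
have le_cross : euclidean_norm (cross u b) <=
    euclidean_norm (u + t *: b) * euclidean_norm b.
  rewrite -(@ler_pXn2r _ 2) ?nnegrE ?mulr_ge0 ?en_ge0 // exprMn !sqr_en.
  rewrite (_ : cross u b = cross (u + t *: b) b) ?cross_cauchy //.
  by rewrite crossDl crossZl crossxx scaler0 addr0.
rewrite (le_trans le_cross) // ler_pM2r ?en_gt0 // (le_trans (en_le_norm _)) //.
by rewrite mulrCA ler_pM2l // mulrC.
Qed.

(** Discrete integration of the support directions along the segment from [u] to [u']: the same
    factors [1 + al t * d] control the sections at every height [l]. As [u] and [u'] have equal norm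
    at height 0, the accumulated factor [a] tends to 1 as the step [d] shrinks. *)
Lemma rotation_le u u' l : dot f u = 0 -> dot f u' = 0 -> cross u u' != 0 ->
  N u = N u' -> N (u + l *: x0) <= N (u' + l *: x0).
Proof.
move=> fu fu' uu' eqN; pose b := u' - u.
have fb : dot f b = 0 by rewrite !dotE fu fu' subrr.
have ubE t : cross (u + t *: b) b = cross u u'.
  rewrite crossDl crossZl crossxx scaler0 addr0 crossDr.
  by rewrite -scaleN1r crossZr crossxx scaler0 addr0.
have fut t : dot f (u + t *: b) = 0 by rewrite dotDr dotZr fb fu mulr0 addr0.
have /choice[al alP] : forall t, exists a, forall d l,
    N ((1 + a * d) *: (u + t *: b) + l *: x0) <= N (u + t *: b + d *: b + l *: x0).
  by move=> t; apply: common_support; rewrite ?ubE.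
have al0 t d : `|1 + al t * d| * N (u + t *: b) <= N (u + (t + d) *: b).
  by have := alP t d 0; rewrite !scale0r !addr0 (is_normZ HN) scalerDl addrA.
have [m m0 mP] : exists2 m, 0 < m & forall t, m <= N (u + t *: b).
  by apply: chord_lower_bound; have := ubE 0; rewrite scale0r addr0 => ->.
(* A unit step changes the norm by at most [N b], so [1 + al t] is at most [1 + N b / m] in absolute
   value. *)
pose A := 2 + N b / m.
have A2 : 2 <= A by rewrite lerDl divr_ge0 ?is_norm_ge0 ?ltW.
have alA t : `|al t| <= A.
  have le1 : `|1 + al t| <= 1 + N b / m.
    have Nt := lt_le_trans m0 (mP t).
    rewrite -(ler_pM2r Nt) (le_trans (_ : _ <= N (u + t *: b) + N b)) //.
      have := al0 t 1; rewrite mulr1 => /le_trans -> //.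
      by rewrite scalerDl scale1r addrA is_normD.
    by rewrite mulrDl mul1r lerD2l mulrAC ler_pdivlMr // ler_wpM2l ?is_norm_ge0.
  rewrite -[al t](addKr 1) addrC (le_trans (ler_normB _ _)) // normr1.
  by rewrite (le_trans (lerD le1 (lexx 1))) // /A; lra.
pose r := N u.
have r0 : 0 < r.
  apply: is_norm_gt0 => //; apply: contra uu' => /eqP ->; exact/eqP/cross0l.
(* [a] is the product of the forward factors, [c] that of the backward ones [1 - al t * d]. Two
   factors at the same [t] multiply to [1 - (al t * d) ^+ 2]; the extra forward factor at the
   current point pairs with the last backward one, and the forward factor at 0 accounts for
   [1 - A * d]. *)
have step n k : 2 * A <= n.+1%:R -> let d := n.+1%:R^-1 in exists a c,
  [/\ 0 < a, 0 < c, forall l, N (a *: u + l *: x0) <= N (u + (k%:R * d) *: b + l *: x0),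
      c * N (u + (k%:R * d) *: b) <= r &
      (1 - A * d) * (1 - k%:R * (A * d) ^+ 2) <= a * c * (1 + al (k%:R * d) * d)].
  move=> n2A d; have d0 : 0 < d by rewrite invr_gt0.
  have Ad : A * d <= 2^-1.
    by rewrite -ler_pdivlMr ?invr_gt0 // invrK mulrC ler_pdivlMr // mulrC.
  have Ad0 : 0 <= A * d by rewrite mulr_ge0 ?(ltW d0) //; lra.
  have ald t : `|al t * d| <= A * d by rewrite normrM (gtr0_norm d0) ler_pM2r.
  have {}ald t : - (A * d) <= al t * d <= A * d by rewrite -ler_norml.
  elim: k => [|k [a [c [a0 c0 aP cP acP]]]].
    exists 1, 1; rewrite !mul0r scale0r addr0; split=> [//|//|l'||].
    - by rewrite scale1r.
    - by rewrite mul1r.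
    - by rewrite subr0 !mul1r mulr1; case/andP: (ald 0) => ? _; lra.
  set t := k%:R * d in aP cP acP; set t' := k.+1%:R * d.
  have tE : t' = t + d by rewrite /t' /t -natr1 mulrDl mul1r.
  have p0 : 0 < 1 + al t * d by case/andP: (ald t) => ? ?; lra.
  have q0 : 0 < 1 - al t' * d by case/andP: (ald t') => ? ?; lra.
  exists ((1 + al t * d) * a), (c * (1 - al t' * d)); split.
  - exact: mulr_gt0.
  - exact: mulr_gt0.
  - move=> l'; rewrite tE scalerDl addrA.
    apply: le_trans (alP t d l').
    (* Dividing by the new factor changes the height, which is why the invariant holds for all
       heights. *)
    rewrite -[l'](mulVKf (lt0r_neq0 p0)) -!scalerA -!scalerDr !(is_normZ HN).
    by rewrite ler_pM2l ?normr_gt0 ?lt0r_neq0 // !scalerA aP.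
  - apply: le_trans cP; rewrite -mulrA ler_pM2l //.
    have := al0 t' (- d); rewrite mulrN gtr0_norm // => /le_trans; apply.
    by rewrite tE addrK.
  - rewrite (_ : _ * _ * _ = a * c * (1 + al t * d) * (1 - (al t' * d) ^+ 2)); last first.
      by ring.
    have x1 : (al t' * d) ^+ 2 <= (A * d) ^+ 2.
      by rewrite -[leLHS]real_normK ?num_real // ler_pXn2r ?nnegrE // ler_norml.
    have x2 : (A * d) ^+ 2 <= 1.
      by rewrite expr_le1 //; lra.
    have E0 : 0 <= a * c * (1 + al t * d) by rewrite !mulr_ge0 // ltW.
    apply: le_trans (ler_wpM2l E0 (lerB (lexx 1) x1)).
    have x3 : 0 <= 1 - (A * d) ^+ 2 by rewrite subr_ge0.
    apply: le_trans (ler_wpM2r x3 acP); rewrite -subr_ge0 -natr1.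
    rewrite (_ : _ - _ = (1 - A * d) * (k%:R * ((A * d) ^+ 2) ^+ 2)); last by ring.
    by rewrite !mulr_ge0 ?exprn_ge0 //; lra.
rewrite leNgt; apply/negP; rewrite -subr_gt0; set X := _ - _ => X0.
(* The first bound keeps all factors positive; the second makes the total error
   [(2 + A) * A * d * r] smaller than the supposed excess [X]. *)
pose B := Num.max (2 * A) ((2 + A) * A * r / X).
have [n Bn] : exists n, B < n.+1%:R.
  exists (Num.bound B); rewrite (lt_trans (archi_boundP _)) ?ltr_nat //.
  by rewrite le_max mulr_ge0 //; lra.
have nA : 2 * A <= n.+1%:R by rewrite (le_trans _ (ltW Bn)) // le_max lexx.
have [a [c []]] := step n n.+1 nA; set d := n.+1%:R^-1.
have kd : n.+1%:R * d = 1 by rewrite divff.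
have d0 : 0 < d by rewrite invr_gt0.
have ub : u + 1 *: b = u' by rewrite scale1r /b addrC subrK.
rewrite kd ub -eqN -/r => a0 c0 aP cP acP.
have a1 : a <= 1.
  by have := aP 0; rewrite !scale0r !addr0 (is_normZ HN) -eqN gtr0_norm // ger_pMl.
have c1 : c <= 1 by rewrite -(ger_pMl _ r0).
have Ad : 0 <= A * d by rewrite mulr_ge0 ?(ltW d0) //; lra.
have Xle : X <= (1 - a) * r.
  rewrite lerBlDr [leRHS]addrC.
  have -> : u + l *: x0 = a *: u + l *: x0 + (1 - a) *: u.
    by rewrite addrAC -scalerDl addrC [a + _]addrC subrK scale1r addrC.
  rewrite (le_trans (is_normD HN _ _)) // lerD ?aP // (is_normZ HN).
  by rewrite ger0_norm // subr_ge0.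
have a_lb : 1 - a <= (2 + A) * A * d.
  have ac : a * c * (1 + al 1 * d) <= a * (1 + A * d).
    rewrite -mulrA ler_pM2l // (@le_trans _ _ (c * (1 + A * d))) //.
      by rewrite ler_pM2l // lerD2l ler_pM2r // (le_trans (ler_norm _)).
    by rewrite ger_pMl // ltr_wpDr.
  have aAd : a * (A * d) <= A * d by rewrite ler_piMl.
  have nx : n.+1%:R * (A * d) ^+ 2 = A * (A * d).
    by rewrite expr2 mulrCA (mulrCA _ A d) kd mulr1 mulrC.
  rewrite nx in acP.
  have : 0 <= A * d * (A * (A * d)) by rewrite !mulr_ge0 //; lra.
  by move: acP ac aAd; lra.
have : X < X.
  apply: le_lt_trans Xle _; apply: le_lt_trans (ler_wpM2r (ltW r0) a_lb) _.
  rewrite mulrAC ltr_pdivrMr ?ltr0Sn // -ltr_pdivrMl // mulrC.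
  by rewrite (le_lt_trans _ Bn) // le_max lexx orbT.
by rewrite ltxx.
Qed.

(** Passing from [u] to [v] and from [v] to [- u] at fixed height reverses [u], and evenness of [N]
    does the rest. The detour by [v] is needed as [rotation_le] compares non-parallel vectors. *)
Lemma tangent_reflection u l : dot f u = 0 -> N (u + l *: x0) = N (u - l *: x0).
Proof.
move=> fu; have [->|u0] := eqVneq u 0; first by rewrite !add0r (is_normN HN).
pose w := cross f u.
have fw : dot f w = 0 by rewrite dot_crossl.
have uw : cross u w = dot u u *: f.
  by rewrite cross_crossr [dot u f]dotC fu scale0r subr0.
have w0 : w != 0.
  apply/eqP => w0; move: uw; rewrite w0 crossC cross0l oppr0 => /esym/eqP.
  by rewrite scaler_eq0 dot_eq0 (negPf u0) (negPf f0).
pose v := (N u / N w) *: w.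
have Nw := is_norm_gt0 HN w0; have Nu := is_norm_gt0 HN u0.
have fv : dot f v = 0 by rewrite dotZr fw mulr0.
have Nv : N v = N u by rewrite (is_normZ HN) gtr0_norm ?divr_gt0 // divfK ?gt_eqF.
have uv : cross u v != 0.
  by rewrite crossZr uw !scaler_eq0 dot_eq0 invr_eq0 !gt_eqF //= negb_or u0.
have vu : cross v u != 0 by rewrite crossC oppr_eq0.
have f_u : dot f (- u) = 0 by rewrite dotNr fu oppr0.
have u_v : cross (- u) v != 0 by rewrite -scaleN1r crossZl scaleN1r oppr_eq0.
have v_u : cross v (- u) != 0 by rewrite crossC oppr_eq0.
have N_u : N (- u) = N u := is_normN HN u.
have rot s t m : dot f s = 0 -> dot f t = 0 -> cross s t != 0 -> N s = N t ->
    N (s + m *: x0) = N (t + m *: x0).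
  move=> fs ft st eN; apply/eqP; rewrite eq_le !rotation_le //.
  by rewrite crossC oppr_eq0.
rewrite (rot u v) // (rot v (- u)) ?Nv ?N_u //.
by rewrite -(is_normN HN (u - _)) opprB addrC.
Qed.

End Rotation.

(** * Determinants of 3 by 3 matrices *)

Lemma det3 (R : comPzRingType) (A : 'M[R]_3) :
  \det A = A i0 i0 * (A i1 i1 * A i2 i2 - A i1 i2 * A i2 i1)
         - A i0 i1 * (A i1 i0 * A i2 i2 - A i1 i2 * A i2 i0)
         + A i0 i2 * (A i1 i0 * A i2 i1 - A i1 i1 * A i2 i0).
Proof.
(* Indexing by natural numbers lets the lifted ordinals coming from the minors compute. *)
pose a (i j : nat) := A (inord i) (inord j).
have aE (i j : 'I_3) : A i j = a i j by rewrite /a !inord_val.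
have -> : A = \matrix_(i, j) a i j by apply/matrixP => i j; rewrite mxE aE.
rewrite !mxE (expand_det_row _ i0) sum3 /cofactor.
do ![rewrite [\det (row' _ _)](expand_det_row _ 0) !big_ord_recl
  big_ord0 /cofactor !det_mx11].
rewrite !mxE /= /bump /=; ring.
Qed.

Lemma dot_mx (R : realType) (x y : 'rV[R]_3) : dot x y = (x *m y^T) 0 0.
Proof. by rewrite mxE sum3 !mxE. Qed.

Lemma dot_mulmx (R : realType) (x y : 'rV[R]_3) (M : 'M[R]_3) :
  dot (x *m M) y = dot x (y *m M^T).
Proof. by rewrite !dot_mx trmx_mul trmxK mulmxA. Qed.

Lemma det_add_rank1 (R : comPzRingType) (x y : 'rV[R]_3) :
  \det (1%:M + x^T *m y) = 1 + dot x y.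
Proof. by rewrite det3 !mxE !big_ord1 !mxE /= /dot; ring. Qed.

(** * The Loewner ellipsoid, of least volume around the unit ball of [N] *)

Section MaxDet.
Context {R : realType} {N : 'rV[R]_3 -> R} (HN : is_norm N).
Local Notation en := (@euclidean_norm R 3).

Definition dominated (M : 'M[R]_3) := forall x, en (x *m M) <= N x.

(** Dominated matrices form a compact set: images of basis vectors bound the entries, and each [x]
    gives a closed condition. A small multiple of the identity is dominated, so the maximum is
    positive. *)
Lemma max_det : exists2 B, dominated B &
  0 < \det B /\ forall M, dominated M -> \det M <= \det B.
Proof.
pose A := [set q : 'rV[R]_(3 * 3) | dominated (vec_mx q)].
have centry i j : continuous (fun q : 'rV[R]_(3 * 3) => vec_mx q i j).
  rewrite (_ : (fun q => _) = fun q : 'rV[R]_(3 * 3) => q 0 (mxvec_index i j)).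
    exact: coord_continuous.
  by apply/funext => q; rewrite mxE.
have cdet : continuous (fun q : 'rV[R]_(3 * 3) => \det (vec_mx q)).
  under eq_fun do rewrite det3.
  have c2 i j k l : continuous (fun q : 'rV[R]_(3 * 3) =>
      vec_mx q i j * vec_mx q k l : R).
    by move=> q; exact: (continuousM (centry i j q) (centry k l q)).
  have c3 i j k l m n o p : continuous (fun q : 'rV[R]_(3 * 3) => vec_mx q i j *
      (vec_mx q k l * vec_mx q m n - vec_mx q k n * vec_mx q o p) : R).
    move=> q; exact: (continuousM (centry i j q)
      (continuousB (c2 k l m n q) (c2 k n o p q))).
  move=> q; exact: (continuousD (continuousB (c3 i0 i0 i1 i1 i2 i2 i2 i1 q)
    (c3 i0 i1 i1 i0 i2 i2 i2 i0 q)) (c3 i0 i2 i1 i0 i2 i1 i2 i0 q)).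
have cA : compact A.
  apply: bounded_closed_compact.
    have [C C0 ub] := is_norm_ub HN; exists C; split; first exact: num_real.
    move=> M ltM q qA /=; rewrite (le_trans _ (ltW ltM)) //.
    rewrite [leLHS]/Num.norm /= mx_normrE; apply/bigmax_leP; split; first exact: ltW.
    move=> [k l] _ /=; rewrite (ord1 k); case/mxvec_indexP: l => i j.
    pose e : 'rV[R]_3 := delta_mx 0 i.
    have -> : q 0 (mxvec_index i j) = (e *m vec_mx q) 0 j.
      by rewrite -rowE !mxE.
    apply: le_trans (_ : en (e *m vec_mx q) <= _).
      rewrite -sqrtr_sqr ler_wsqrtr // (bigD1 j) //= lerDl.
      by rewrite sumr_ge0 // => m _; rewrite sqr_ge0.
    rewrite (le_trans (qA _)) // (le_trans (ub _)) // ger_pMr //.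
    rewrite [leLHS]/Num.norm /= mx_normrE; apply/bigmax_leP; split=> // -[m p] _ /=.
    by rewrite mxE; case: (_ && _); rewrite ?normr1 ?normr0.
  rewrite (_ : A = \bigcap_(x in setT)
      [set q | dot (x *m vec_mx q) (x *m vec_mx q) <= N x ^+ 2]).
    apply: closed_bigI => x _; apply: closed_le_cont.
    have cx j : continuous (fun q : 'rV[R]_(3 * 3) => (x *m vec_mx q) 0 j).
      rewrite (_ : (fun q => _) = fun q : 'rV[R]_(3 * 3) => x 0 i0 * vec_mx q i0 j +
        x 0 i1 * vec_mx q i1 j + x 0 i2 * vec_mx q i2 j); last first.
        by apply/funext => q; rewrite mxE sum3.
      have c1 i : continuous (fun q : 'rV[R]_(3 * 3) => x 0 i * vec_mx q i j).
        by move=> q; exact: (continuousM (@cst_continuous _ _ (x 0 i) q) (centry i j q)).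
      by move=> q; exact: (continuousD (continuousD (c1 i0 q) (c1 i1 q)) (c1 i2 q)).
    have cxx j : continuous (fun q : 'rV[R]_(3 * 3) =>
        (x *m vec_mx q) 0 j * (x *m vec_mx q) 0 j).
      by move=> q; exact: (continuousM (cx j q) (cx j q)).
    by move=> q; exact: (continuousD (continuousD (cxx i0 q) (cxx i1 q)) (cxx i2 q)).
  apply/seteqP; split=> q qA x; last first.
    have := qA x I => /=; rewrite -sqr_en ler_pXn2r ?nnegrE ?en_ge0 //.
    exact: is_norm_ge0.
  by move=> _ /=; rewrite -sqr_en ler_pXn2r ?nnegrE ?en_ge0 ?is_norm_ge0.
have [D D0 lb] := is_norm_lb HN.
have dom1 : dominated ((2 * D)^-1%:M).
  move=> x; rewrite mul_mx_scalar enZ gtr0_norm ?invr_gt0 ?mulr_gt0 //.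
  rewrite mulrC ler_pdivrMr ?mulr_gt0 // (le_trans (en_le_norm _)) //.
  by rewrite mulrCA ler_pM2l // mulrC.
have domA M : dominated M -> mxvec M \in A.
  by move=> domM; apply/mem_set; rewrite /A /= mxvecK.
have [||q /set_mem qA qmax] :=
  @compact_EVT_max _ _ (fun q : 'rV[R]_(3 * 3) => \det (vec_mx q)) _ _ cA.
- by exists (mxvec (2 * D)^-1%:M); exact/set_mem/domA.
- exact/continuous_subspaceT/cdet.
have {}qmax M : dominated M -> \det M <= \det (vec_mx q).
  by move=> /domA/qmax; rewrite mxvecK.
exists (vec_mx q) => //; split=> //.
apply: lt_le_trans (qmax _ dom1).
by rewrite det_scalar exprn_gt0 // invr_gt0 mulr_gt0.
Qed.

(* If x0 B were not orthogonal to f^perp B, moving it to the normal while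
   fixing f^perp B would increase the determinant; by the reflection symmetry
   of N the new matrix is still dominated. *)
Lemma max_det_orth B x0 f : dominated B -> 0 < \det B ->
  (forall M, dominated M -> \det M <= \det B) -> dot f x0 != 0 ->
  (forall u l, dot f u = 0 -> N (u + l *: x0) = N (u - l *: x0)) ->
  forall u, dot f u = 0 -> dot (x0 *m B) (u *m B) = 0.
Proof.
move=> domB detB maxB fx0 refl.
have unitB : B \in unitmx by rewrite unitmxE unitfE gt_eqF.
(* [n] is normal to the image under [B] of the plane [f^perp]. *)
pose w := x0 *m B; pose n := f *m (invmx B)^T; pose c := dot f x0.
have nE z : dot n (z *m B) = dot f z.
  by rewrite dot_mulmx trmxK -mulmxA mulmxV // mulmx1.
have nw : dot n w = c by rewrite nE.
have n0 : n != 0.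
  by apply: contra fx0 => /eqP n0; rewrite -nE n0 /dot !mxE !mul0r !addr0.
have w0 : w != 0.
  by apply: contra fx0 => /eqP w0; rewrite -nE -/w w0 /dot !mxE !mulr0 !addr0.
have nn : 0 < dot n n by rewrite dot_gt0.
have ww : 0 < dot w w by rewrite dot_gt0.
(* The map [T] below fixes [n^perp] and sends [w] to [s *: n], which has the length of [w] and lies
   on the same side, so that [\det T] is positive. *)
pose s := Num.sg c * (en w / en n).
have s2 : s ^+ 2 * dot n n = dot w w.
  rewrite exprMn sqr_sg fx0 mul1r exprMn exprVn !sqr_en -mulrA mulVf ?mulr1 //.
  by rewrite gt_eqF.
pose v := c^-1 *: (s *: n - w).
pose T := 1%:M + n^T *m v.
have TE z : z *m T = z + dot n z *: v.
  rewrite /T mulmxDr mulmx1 mulmxA; congr (_ + _).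
  rewrite dotC dot_mx; apply/rowP => j; rewrite mxE big_ord1 mxE.
  by rewrite [(_ *: v) _ _]mxE.
(* By Pythagoras the squared length of [z *m (B *m T)] is the mean of those of [(u + l *: x0) *m B]
   and [(u - l *: x0) *m B], both at most [N z ^+ 2] by the symmetry. *)
have domT : dominated (B *m T).
  move=> z; pose l := dot f z / c; pose u := z - l *: x0.
  have fu : dot f u = 0 by rewrite !dotE /l divfK // subrr.
  have zE : z = u + l *: x0 by rewrite subrK.
  have lE : dot f z = l * c by rewrite divfK.
  clearbody u l.
  have zT : z *m (B *m T) = u *m B + (l * s) *: n.
    rewrite mulmxA TE nE lE zE mulmxDl -scalemxAl -/w.
    rewrite /v scalerA -mulrA divff // mulr1 scalerBr addrA -addrA.
    by rewrite -scalerA addrACA subrr addr0.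
  rewrite -(@ler_pXn2r _ 2) ?nnegrE ?en_ge0 ?is_norm_ge0 // sqr_en zT.
  have un : dot n (u *m B) = 0 by rewrite nE.
  have := domB (u + l *: x0); have := domB (u - l *: x0).
  rewrite -(refl u l fu) -zE => le1 le2.
  have {}le1 : en ((u - l *: x0) *m B) ^+ 2 <= N z ^+ 2.
    by rewrite ler_pXn2r ?nnegrE ?en_ge0 ?is_norm_ge0.
  have {}le2 : en (z *m B) ^+ 2 <= N z ^+ 2.
    by rewrite ler_pXn2r ?nnegrE ?en_ge0 ?is_norm_ge0.
  move: le1 le2; rewrite !sqr_en [in z *m B]zE mulmxBl mulmxDl -scalemxAl -/w.
  move: (u *m B) un => uB un; rewrite !dotE [dot uB n]dotC un.
  rewrite [dot uB w]dotC => le1 le2.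
  have : (l * s) * ((l * s) * dot n n) = l ^+ 2 * dot w w by rewrite -s2; ring.
  by move: le1 le2; lra.
have detT : \det T = `|c|^-1 * (en w * en n).
  rewrite det_add_rank1 /v !dotE nw mulrBr mulVf // addrC subrK /s -sqr_en.
  rewrite [X in _ * X = _](_ : _ = Num.sg c * (en w * en n)); last first.
    by field; rewrite gt_eqF // en_gt0.
  by rewrite mulrA; congr (_ * _); rewrite -normfV normrEsg sgrV mulrC.
(* Maximality gives [\det T <= 1], a reversed Cauchy-Schwarz inequality, so [n] and [w] are
   parallel. *)
have le_c : en w * en n <= `|c|.
  have := maxB _ domT; rewrite det_mulmx ger_pMr // detT.
  by rewrite mulrC ler_pdivrMr ?mul1r ?normr_gt0.
have nw0 : cross n w = 0.
  apply/eqP; rewrite -dot_eq0 eq_le dot_ge0 andbT.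
  rewrite (_ : dot _ _ = dot w w * dot n n - dot n w ^+ 2).
    rewrite subr_le0 nw -!sqr_en -exprMn -[leRHS]real_normK ?num_real //.
    by rewrite ler_pXn2r ?nnegrE ?mulr_ge0 ?en_ge0.
  by rewrite /dot !mxE /=; ring.
have [k wE] := cross_eq0_colinear n0 nw0.
by move=> u fu; rewrite -/w wE dotZl nE fu mulr0.
Qed.

End MaxDet.

(** * Proportionality of [N] to a Euclidean norm *)

Section Euclidean.
Context {R : realType} {N : 'rV[R]_3 -> R} (HN : is_norm N).
Context {B : 'M[R]_3} (unitB : B \in unitmx).
Local Notation en := (@euclidean_norm R 3).

Implicit Types x y z u f : 'rV[R]_3.

Hypothesis refl : forall x e, x != 0 -> 0 < e -> exists x0 f,
  [/\ dot (x0 - x) (x0 - x) <= e, dot f x0 != 0,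
      forall u l, dot f u = 0 -> N (u + l *: x0) = N (u - l *: x0) &
      forall u, dot f u = 0 -> dot (x0 *m B) (u *m B) = 0].

Lemma mulmx_eq0 x : (x *m B == 0) = (x == 0).
Proof.
apply/eqP/eqP => [xB|->]; last exact: mul0mx.
by rewrite -[x]mulmx1 -(mulmxV unitB) mulmxA xB mul0mx.
Qed.

(** The reflection reversing [x - y], orthogonal for the norm of [x *m B], swaps [x] and [y].
    Reflections known to preserve [N] reverse only vectors close to [x - y], so continuity is
    used. *)
Lemma norm_eq_of_en x y : en (x *m B) = en (y *m B) -> N x = N y.
Proof.
move=> eq_en; have [->//|xy] := eqVneq x y.
pose p := x - y; have p0 : p != 0 by rewrite subr_eq0.
pose q z := dot (z *m B) (z *m B); pose b z := dot (z *m B) (x *m B).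
(* [v z] is [q z] times the image of [x] under the orthogonal reflection reversing [z], the factor
   avoiding a division; [G z = 0] expresses that this reflection keeps the norm of [x]. *)
pose v z : 'rV[R]_3 := q z *: x - (2 * b z) *: z.
pose G z := N (v z) - q z * N x.
have cB j : continuous (fun z : 'rV[R]_3 => (z *m B) 0 j).
  under eq_fun do rewrite mxE sum3.
  have c i : continuous (fun z : 'rV[R]_3 => z 0 i * B i j).
    by move=> z; exact: (continuousM (@coord_continuous _ _ _ 0 i z)
      (@cst_continuous _ _ (B i j) z)).
  by move=> z; exact: (continuousD (continuousD (c i0 z) (c i1 z)) (c i2 z)).
have cq : continuous q.
  have c j : continuous (fun z : 'rV[R]_3 => (z *m B) 0 j * (z *m B) 0 j).
    by move=> z; exact: (continuousM (cB j z) (cB j z)).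
  by move=> z; exact: (continuousD (continuousD (c i0 z) (c i1 z)) (c i2 z)).
have cb : continuous b.
  have c j : continuous (fun z : 'rV[R]_3 => (z *m B) 0 j * (x *m B) 0 j).
    by move=> z; exact: (continuousM (cB j z) (@cst_continuous _ _ ((x *m B) 0 j) z)).
  by move=> z; exact: (continuousD (continuousD (c i0 z) (c i1 z)) (c i2 z)).
have c2b : continuous (fun z => 2 * b z).
  by move=> z; exact: (continuousM (@cst_continuous _ _ (2 : R) z) (cb z)).
have cv : continuous v.
  move=> z; apply: (@continuousB _ _ _ (fun z => q z *: x) (fun z => (2 * b z) *: z)).
    by apply: continuousZ; [exact: cq | exact: cst_continuous].
  apply: continuousZ; last exact: cvg_id.
  exact: c2b.
have cG : continuous G.
  move=> z; apply: (@continuousB _ _ _ (fun z => N (v z)) (fun z => q z * N x)).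
    apply: (@continuous_comp _ _ _ v N); first exact: cv.
    exact: (is_norm_continuous HN).
  exact: (continuousM (cq z) (@cst_continuous _ _ (N x) z)).
have Gp : G p = 0.
  have /continuous_closedP/(_ _ (@closed_eq _ 0)) clG := cG.
  apply: clG => U /nbhs_ballP[d /= d0 dU].
  have e0 : 0 < (d / 2) ^+ 2 by rewrite exprn_gt0 // divr_gt0.
  have [z [f [zp fz rf of_]]] := refl p0 e0.
  exists z; split; last first.
    apply: dU; rewrite -ball_normE /= (le_lt_trans (norm_le_en _)) //.
    apply: (@le_lt_trans _ _ (d / 2)); last by rewrite ltr_pdivrMr // ltr_pMr // ltr1n.
    rewrite -opprB enN -(@ler_pXn2r _ 2) ?nnegrE ?en_ge0 ?divr_ge0 ?(ltW d0) //.
    by rewrite sqr_en.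
  pose l := dot f x / dot f z; pose u := x - l *: z.
  have fu : dot f u = 0 by rewrite !dotE /l divfK // subrr.
  have xE : x = u + l *: z by rewrite subrK.
  have bE : b z = l * q z.
    by rewrite /b /q xE mulmxDl -scalemxAl dotDr dotZr of_ // add0r.
  rewrite /= /G.
  have -> : v z = q z *: (u - l *: z).
    rewrite /v bE {1}xE; apply/rowP => i; rewrite !mxE; ring.
  rewrite (is_normZ HN) ger0_norm ?dot_ge0 // -(rf _ _ fu) -xE.
  exact: subrr.
have qp : 0 < q p by rewrite /q dot_gt0 mulmx_eq0.
(* Equal lengths give this identity, by which [v p] is [q p *: y]. *)
have b2 : 2 * b p = q p.
  have : dot (x *m B) (x *m B) = dot (y *m B) (y *m B) by rewrite -!sqr_en eq_en.
  rewrite /b /q /p mulmxBl !dotE [dot (y *m B) (x *m B)]dotC; lra.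
move: Gp; rewrite /G /v b2 -scalerBr (is_normZ HN) gtr0_norm //.
move/eqP; rewrite -mulrBr mulf_eq0 gt_eqF //= subr_eq0 => /eqP <-.
by rewrite /p opprB addrC subrK.
Qed.

Lemma norm_proportional : exists2 k, 0 < k & forall x, N x = k * en (x *m B).
Proof.
pose e : 'rV[R]_3 := row3 1 0 0.
have e0 : e != 0.
  by apply/eqP => /rowP /(_ i0); rewrite !mxE /= => /eqP; rewrite oner_eq0.
have eB : 0 < en (e *m B) by rewrite en_gt0 mulmx_eq0.
exists (N e / en (e *m B)) => [|x]; first by rewrite divr_gt0 // is_norm_gt0.
have [->|x0] := eqVneq x 0.
  by rewrite mul0mx (is_norm0 HN) [en 0]enE /dot !mxE !mulr0 !addr0 sqrtr0 mulr0.
have xB : 0 < en (x *m B) by rewrite en_gt0 mulmx_eq0.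
have := @norm_eq_of_en ((en (e *m B) / en (x *m B)) *: x) e.
rewrite -scalemxAl enZ (is_normZ HN) gtr0_norm ?divr_gt0 // divfK ?gt_eqF //.
by move=> /(_ erefl) <-; field; rewrite !gt_eqF.
Qed.

End Euclidean.

Theorem theorem3 (R : realType) (K : set 'rV[R]_3) :
  symmetric_convex_body K -> intuitive K -> ellipsoid K.
Proof.
move=> bodyK intK; have HN := body_norm_is_norm bodyK.
have [B domB [detB maxB]] := max_det HN.
have unitB : B \in unitmx by rewrite unitmxE unitfE gt_eqF.
have [x e x0 e0|k k0 NE] := norm_proportional HN unitB.
  have [z [f [zx fz tan]]] := contact_point HN x0 e0.
  have refl u l : dot f u = 0 ->
      body_norm K (u + l *: z) = body_norm K (u - l *: z).
    by apply: (tangent_reflection HN (plane_projection HN intK) fz tan).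
  by exists z, f; split=> //; exact: max_det_orth domB detB maxB fz refl.
have unitkB : k *: B \in unitmx by rewrite unitmxZ // unitfE gt_eqF.
(* [K] is the preimage of the Euclidean ball under [k *: B], whereas an ellipsoid is an image, hence
   the inverse. *)
exists (invmx (k *: B)), 0; split; first by rewrite unitmx_inv.
rewrite [LHS](body_norm_ballE bodyK); apply/seteqP; split=> x /=.
  rewrite NE => le1; exists (x *m (k *: B)); last by rewrite addr0 mulmxK.
  by rewrite /= -scalemxAr enZ gtr0_norm.
move=> [y /= y1 <-]; rewrite addr0 NE -{1}(gtr0_norm k0) -enZ scalemxAr.
by rewrite mulmxKV.
Qed.
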